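(* Let $n\ge 2$, let $N=\binom n2$, and let $q$ be a positive real number. Let $S:\mathrm{Braid}_n\to GL_N(\mathbb{R})$ be the simplicial representation of the $n$-string braid group with parameter $q$. Let $\mathcal{D}_n\subset \mathbb{R}^N$ be the set of column vectors $(a_{kl})_{1\le k<l\le n}$ of positive real numbers for which there is a nondegenerate euclidean simplex with $n$ labeled vertices $p_1,\dots,p_n$ (i.e. $n$ affinely independent points of an $(n-1)$-dimensional euclidean space) such that $a_{kl}=\|p_k-p_l\|^2$ for all $k<l$. Then the simplicial representation preserves $\mathcal{D}_n$: for every $\beta\in\mathrm{Braid}_n$ and every $\mathbf{v}\in\mathcal{D}_n$, one has $S(\beta)\cdot\mathbf{v}\in\mathcal{D}_n$.
   Context: $\mathrm{Braid}_n$ is the braid group with standard generators $s_{12},s_{23},\dots,s_{n-1,n}$ (satisfying the usual braid relations $s_{i,i+1}s_{i+1,i+2}s_{i,i+1}=s_{i+1,i+2}s_{i,i+1}s_{i+1,i+2}$, and commutation of $s_{i,i+1}$ with $s_{k,k+1}$ when $|i-k|\ge2$). Let $\{e_{kl}: 1\le k<l\le n\}$, in lexicographic order, be the standard ordered basis of $\mathbb{R}^N$, and write $e_{kl}=e_{lk}$. For an $N\times N$ matrix $M$, $(e_{kl})M$ denotes the row of $M$ indexed by $e_{kl}$, written as a linear combination of basis vectors (so the coefficient of $e_{ab}$ in $(e_{kl})M$ is the entry of $M$ in row $kl$ and column $ab$). The simplicial representation (the Lawrence-Krammer-Bigelow representation in Krammer's conventions with $t=1$) is the homomorphism $S:\mathrm{Braid}_n\to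 GL_N(\mathbb{R})$ (with ordinary matrix multiplication, $S(\alpha\beta)=S(\alpha)S(\beta)$) sending each standard generator $s_{ij}$, $j=i+1$, $1\le i<n$, to the matrix $S_{ij}$ with rows, for $k<l$: \begin{itemize} \item $(e_{kl})S_{ij}=q^2e_{kl}$ if $k=i$, $l=j$; \item $(e_{kl})S_{ij}=e_{kl}$ if $i,j\notin\{k,l\}$; \item $(e_{kl})S_{ij}=e_{jl}$ if $k=i$ and $j<l$; \item $(e_{kl})S_{ij}=e_{kj}$ if $l=i$; \item $(e_{kl})S_{ij}=(q^2-q)e_{ij}+q\,e_{ki}+(1-q)e_{kl}$ if $k<i$ and $l=j$; \item $(e_{kl})S_{ij}=(q^2-q)e_{ij}+q\,e_{il}+(1-q)e_{kl}$ if $k=j$. \end{itemize} Matrices act on column vectors of squared edge lengths by left multiplication. *)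

(* Defs.v *)
From HB Require Import structures.
From mathcomp Require Import all_boot all_order all_algebra.
From mathcomp Require Import generic_quotient boolp classical_sets reals.
From mathcomp Require Import ring zify.

Set Implicit Arguments.
Unset Strict Implicit.
Unset Printing Implicit Defensive.

Import Order.TTheory GRing.Theory Num.Theory.

Local Open Scope ring_scope.

Section BraidGroup.
Variable n : nat.

(* The generator s_{k,k+1} is represented by the 0-based index k-1 : 'I_n.-1. *)
Definition lo (i : 'I_n.-1) : 'I_n := widen_ord (leq_pred n) i.

Fact hi_subproof (i : 'I_n.-1) : (i.+1 < n)%N.
Proof. by rewrite -ltn_predRL. Qed.

Definition hi (i : 'I_n.-1) : 'I_n := Ordinal (hi_subproof i).

(* The letter (i, true) is s_i and (i, false) is its formal inverse. *)
Definition letter : Type := ('I_n.-1 * bool)%type.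
HB.instance Definition _ := Countable.on letter.

Definition word : Type := seq letter.
HB.instance Definition _ := Countable.on word.

Definition inv_letter (a : letter) : letter := (a.1, ~~ a.2).
Definition inv_word (w : word) : word := rev (map inv_letter w).

Inductive braid_eq : word -> word -> Prop :=
| braid_refl u : braid_eq u u
| braid_sym u v : braid_eq u v -> braid_eq v u
| braid_trans u v w : braid_eq u v -> braid_eq v w -> braid_eq u w
| braid_cat u u' v v' :
    braid_eq u u' -> braid_eq v v' -> braid_eq (u ++ v) (u' ++ v')
| braid_cancel a : braid_eq [:: a; inv_letter a] [::]
| braid_braid (i j : 'I_n.-1) : j = i.+1 :> nat ->
    braid_eq [:: (i, true); (j, true); (i, true)]
             [:: (j, true); (i, true); (j, true)]
| braid_comm (i j : 'I_n.-1) : ((i.+2 <= j) || (j.+2 <= i))%N ->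
    braid_eq [:: (i, true); (j, true)] [:: (j, true); (i, true)].

Definition braid_rel : rel word := fun u v => `[< braid_eq u v >].

Fact braid_rel_equiv : equiv_class_of braid_rel.
Proof.
split=> [u|u v|v u w].
- exact/asboolP/braid_refl.
- by apply/asboolP/asboolP; apply: braid_sym.
- by move=> /asboolP uv /asboolP vw; apply/asboolP/(braid_trans uv).
Qed.

Canonical braid_equiv := EquivRelPack braid_rel_equiv.

Definition Braid : Type := {eq_quot braid_equiv}%qT.
HB.instance Definition _ := Choice.on Braid.
HB.instance Definition _ := EqQuotient.on Braid.

Lemma braid_piP (u v : word) :
  (\pi_(Braid) u = \pi_(Braid) v)%qT <-> braid_eq u v.
Proof.
split; first by move=> /eqmodP /asboolP.
by move=> uv; apply/eqmodP/asboolP.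
Qed.

Lemma braid_reprP (u : word) : braid_eq (repr (\pi_(Braid) u)%qT) u.
Proof. by apply/braid_piP; rewrite reprK. Qed.

Definition braid_one : Braid := (\pi_(Braid) ([::] : word))%qT.
Definition braid_mul (x y : Braid) : Braid :=
  (\pi_(Braid) (repr x ++ repr y : word))%qT.
Definition braid_inv (x : Braid) : Braid :=
  (\pi_(Braid) (inv_word (repr x)))%qT.

Lemma inv_letterK : involutive inv_letter.
Proof. by case=> i b; rewrite /inv_letter /= negbK. Qed.

Lemma inv_wordK : involutive inv_word.
Proof. by move=> w; rewrite /inv_word map_rev revK (mapK inv_letterK). Qed.

Lemma braid_catV (w : word) : braid_eq (w ++ inv_word w) [::].
Proof.
elim: w => [|a w IHw]; first exact: braid_refl.
have -> : (a :: w) ++ inv_word (a :: w) =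
    [:: a] ++ (w ++ inv_word w) ++ [:: inv_letter a].
  by rewrite /inv_word /= rev_cons -cats1 -catA.
apply: braid_trans (braid_cancel a); apply: (@braid_cat [:: a] [:: a]).
  exact: braid_refl.
by rewrite -[X in braid_eq _ X]cat0s; apply: braid_cat IHw (braid_refl _).
Qed.

Lemma braid_Vcat (w : word) : braid_eq (inv_word w ++ w) [::].
Proof. by rewrite -{2}[w]inv_wordK; apply: braid_catV. Qed.

Fact braid_mulA : associative braid_mul.
Proof.
move=> x y z; apply/braid_piP.
apply: (@braid_trans _ (repr x ++ (repr y ++ repr z))).
  by apply: braid_cat; [exact: braid_refl | exact: braid_reprP].
rewrite catA; apply: braid_sym.
by apply: braid_cat; [exact: braid_reprP | exact: braid_refl].
Qed.

Fact braid_mul1 : left_id braid_one braid_mul.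
Proof.
move=> x; rewrite -[RHS]reprK; apply/braid_piP.
rewrite -[X in braid_eq _ X]cat0s.
by apply: braid_cat; [exact: braid_reprP | exact: braid_refl].
Qed.

Fact braid_mulr1 : right_id braid_one braid_mul.
Proof.
move=> x; rewrite -[RHS]reprK; apply/braid_piP.
rewrite -[X in braid_eq _ X]cats0.
by apply: braid_cat; [exact: braid_refl | exact: braid_reprP].
Qed.

Fact braid_mulV : left_inverse braid_one braid_inv braid_mul.
Proof.
move=> x; apply/braid_piP; apply: braid_trans (braid_Vcat (repr x)).
by apply: braid_cat; [exact: braid_reprP | exact: braid_refl].
Qed.

Fact braid_mulrV : right_inverse braid_one braid_inv braid_mul.
Proof.
move=> x; apply/braid_piP; apply: braid_trans (braid_catV (repr x)).
by apply: braid_cat; [exact: braid_refl | exact: braid_reprP].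
Qed.

HB.instance Definition _ := isGroup.Build Braid
  braid_mulA braid_mul1 braid_mulr1 braid_mulV braid_mulrV.

Definition braid_gen (i : 'I_n.-1) : Braid :=
  (\pi_(Braid) ([:: (i, true)] : word))%qT.

End BraidGroup.

Section BraidLift.
Local Open Scope group_scope.
Variables (n : nat) (G : groupType) (f : 'I_n.-1 -> G).
Hypothesis f_braid : forall i j : 'I_n.-1, j = i.+1 :> nat ->
  f i * f j * f i = f j * f i * f j.
Hypothesis f_comm : forall i j : 'I_n.-1, (i.+2 <= j)%N ->
  f i * f j = f j * f i.

Definition letter_eval (a : letter n) : G := if a.2 then f a.1 else (f a.1)^-1.
Definition word_eval (w : word n) : G :=
  foldr (fun a g => letter_eval a * g) 1 w.

Lemma word_eval_cat u v : word_eval (u ++ v) = word_eval u * word_eval v.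
Proof. by elim: u => [|a u IHu] /=; rewrite ?mul1g // IHu mulgA. Qed.

Lemma word_eval_eq u v : braid_eq u v -> word_eval u = word_eval v.
Proof.
elim=> {u v} /=.
- by [].
- by move=> u v _ ->.
- by move=> u v w _ -> _ ->.
- by move=> u u' v v' _ IHu _ IHv; rewrite !word_eval_cat IHu IHv.
- by case=> i []; rewrite /= /letter_eval /= mulg1 ?mulgV ?mulVg.
- by move=> i j ij; rewrite /letter_eval /= !mulg1 !mulgA f_braid.
- move=> i j /= /orP[ij|ji]; rewrite /letter_eval /= !mulg1; first exact: f_comm.
  by rewrite (f_comm ji).
Qed.

Definition braid_lift (x : Braid n) : G := word_eval (repr x).

Lemma braid_liftM : {morph braid_lift : x y / x * y}.
Proof.
move=> x y; rewrite /braid_lift -word_eval_cat.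
exact/word_eval_eq/braid_reprP.
Qed.

Lemma braid_lift_gen i : braid_lift (braid_gen i) = f i.
Proof.
by rewrite /braid_lift (word_eval_eq (braid_reprP _)) /= /letter_eval mulg1.
Qed.

End BraidLift.

(* MathComp's general linear groups are only defined over finite rings. *)
Section GeneralLinearGroup.
Variables (R : realType) (m : nat).

Record GL : Type := MkGL { GL_mx :> 'M[R]_m; _ : GL_mx \in unitmx }.
HB.instance Definition _ := [isSub for GL_mx].
HB.instance Definition _ := [Choice of GL by <:].

Lemma GL_unit (A : GL) : GL_mx A \in unitmx. Proof. exact: (valP A). Qed.

Fact GL_mul_subproof (A B : GL) : GL_mx A *m GL_mx B \in unitmx.
Proof. by rewrite unitmx_mul !GL_unit. Qed.
Fact GL_inv_subproof (A : GL) : invmx (GL_mx A) \in unitmx.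
Proof. by rewrite unitmx_inv GL_unit. Qed.

Definition GL_one : GL := MkGL (unitmx1 R m).
Definition GL_mul (A B : GL) : GL := MkGL (GL_mul_subproof A B).
Definition GL_inv (A : GL) : GL := MkGL (GL_inv_subproof A).

Fact GL_mulA : associative GL_mul.
Proof. by move=> A B C; apply: val_inj; rewrite /= mulmxA. Qed.
Fact GL_mul1 : left_id GL_one GL_mul.
Proof. by move=> A; apply: val_inj; rewrite /= mul1mx. Qed.
Fact GL_mulr1 : right_id GL_one GL_mul.
Proof. by move=> A; apply: val_inj; rewrite /= mulmx1. Qed.
Fact GL_mulV : left_inverse GL_one GL_inv GL_mul.
Proof. by move=> A; apply: val_inj; rewrite /= mulVmx ?GL_unit. Qed.
Fact GL_mulrV : right_inverse GL_one GL_inv GL_mul.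
Proof. by move=> A; apply: val_inj; rewrite /= mulmxV ?GL_unit. Qed.

HB.instance Definition _ := isGroup.Build GL
  GL_mulA GL_mul1 GL_mulr1 GL_mulV GL_mulrV.

End GeneralLinearGroup.

Section Edges.
Variable n : nat.

Definition edge : Type := {p : 'I_n * 'I_n | (p.1 < p.2)%N}.
HB.instance Definition _ := Finite.on edge.

Definition mk_edge (k l : 'I_n) (kl : (k < l)%N) : edge := exist _ (k, l) kl.

Lemma card_edge : #|{: edge}| = 'C(n, 2).
Proof.
rewrite card_sig -sum1_card -bin2_sum big_mkord.
have -> : (\sum_(p in [pred p : 'I_n * 'I_n | (p.1 < p.2)%N]) 1 =
    \sum_(j < n) \sum_(i < n | (i < j)%N) 1)%N.
  rewrite (exchange_big_dep xpredT) //= pair_big_dep /=.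
  by apply: eq_bigl => -[i j].
apply: eq_bigr => j _.
by rewrite (big_ord_narrow (ltnW (ltn_ord j))) sum1_card card_ord.
Qed.

(* [enum] lists the pairs (k, l) in lexicographic order, so these are the
   mutually inverse bijections between edges and their lexicographic rank. *)
Definition edge_rank (e : edge) : 'I_'C(n, 2) :=
  cast_ord card_edge (enum_rank e).
Definition rank_edge (r : 'I_'C(n, 2)) : edge :=
  enum_val (cast_ord (esym card_edge) r).

Lemma edge_rankK : cancel edge_rank rank_edge.
Proof.
by move=> e; rewrite /rank_edge /edge_rank cast_ordK enum_rankK.
Qed.

Lemma rank_edgeK : cancel rank_edge edge_rank.
Proof.
by move=> r; rewrite /rank_edge /edge_rank enum_valK cast_ordKV.
Qed.

Lemma val_enum_edge : [seq val e | e <- enum {: edge}] =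
  [seq p : 'I_n * 'I_n <- [seq (k, l) | k <- enum 'I_n, l <- enum 'I_n]
     | (p.1 < p.2)%N].
Proof.
rewrite [in LHS]enumT unlock /=.
apply: (etrans (pmap_filter (@insubK _ _ edge) _)).
rewrite (eq_filter (isSome_insub edge)); congr filter.
by rewrite unlock /= /prod_enum.
Qed.

End Edges.

Section SimplicialAction.
Variables (R : comPzRingType) (T : eqType) (q : R).

(* The action of S_{ij} on columns, seen as symmetric functions w on pairs of
   vertices vanishing on the diagonal. *)
Definition simplicial_act (i j : T) (w : T -> T -> R) (k l : T) : R :=
  if k == l then 0
  else if (k == i) && (l == j) || (k == j) && (l == i) then q ^+ 2 * w i j
  else if k == i then w j l
  else if l == i then w k j
  else if k == j then (q ^+ 2 - q) * w i j + q * w i l + (1 - q) * w k l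
  else if l == j then (q ^+ 2 - q) * w i j + q * w k i + (1 - q) * w k l
  else w k l.

Lemma simplicial_act_sym i j w k l : (forall a b, w a b = w b a) -> i != j ->
  simplicial_act i j w k l = simplicial_act i j w l k.
Proof.
move=> wC ij; rewrite /simplicial_act (wC l k) (wC k j) (wC l j) (wC k i) (wC l i).
have ji : j != i by rewrite eq_sym.
rewrite (eq_sym l k) (andbC (l == i)) (andbC (l == j)) orbC.
case: (eqVneq k l) => [//|kl].
case: (eqVneq k i) kl => [->|ki] kl; [|case: (eqVneq k j) kl => [->|kj] kl];
  (case: (eqVneq l i) kl => [->|li] kl; [|case: (eqVneq l j) kl => [->|lj] kl]);
  by rewrite ?eqxx ?(negPf ij) ?(negPf ji) //= ?eqxx in kl *.
Qed.

Lemma simplicial_act_ext i j w w' : w =2 w' ->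
  simplicial_act i j w =2 simplicial_act i j w'.
Proof. by move=> ww' k l; rewrite /simplicial_act !ww'. Qed.

Local Ltac ev := repeat (rewrite ?eqxx /=;
  match goal with
  | H : is_true (?x != ?y) |- context [?x == ?y] => rewrite (negPf H) /=
  | H : is_true (?x != ?y) |- context [?y == ?x] => rewrite (eq_sym y x) (negPf H) /=
  end); rewrite ?eqxx /=.

Lemma simplicial_act_braid (a b c : T) w :
  (forall k l, w k l = w l k) ->
  a != b -> b != c -> a != c ->
  simplicial_act a b (simplicial_act b c (simplicial_act a b w)) =2
  simplicial_act b c (simplicial_act a b (simplicial_act b c w)).
Proof.
move=> wC ab bc ac k l.
have [kl|kl] := eqVneq k l; first by rewrite /simplicial_act kl eqxx.
pose u1 := simplicial_act a b w; pose u2 := simplicial_act b c u1.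
pose v1 := simplicial_act b c w; pose v2 := simplicial_act a b v1.
rewrite -/u1 -/u2 -/v1 -/v2.
have Eu1 : u1 =2 simplicial_act a b w by [].
have Eu2 : u2 =2 simplicial_act b c u1 by [].
have Ev1 : v1 =2 simplicial_act b c w by [].
have Ev2 : v2 =2 simplicial_act a b v1 by [].
clearbody u2; clearbody u1; clearbody v2; clearbody v1.
have ba : b != a by rewrite eq_sym.
have cb : c != b by rewrite eq_sym.
have ca : c != a by rewrite eq_sym.
have lk : l != k by rewrite eq_sym.
have [kE|ka] := eqVneq k a; [|have [kE|kb] := eqVneq k b;
  [|have [kE|kc] := eqVneq k c]];
(have [lE|la] := eqVneq l a; [|have [lE|lb] := eqVneq l b;
  [|have [lE|lc] := eqVneq l c]]).
all: try by rewrite kE lE eqxx in kl.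
all: subst; rewrite /simplicial_act; ev.
all: rewrite ?(Eu2, Ev2) /simplicial_act; ev.
all: rewrite ?(Eu1, Ev1) /simplicial_act; ev.
all: rewrite ?(wC b a) ?(wC c a) ?(wC c b) ?(wC a k) ?(wC b k) ?(wC c k)
  ?(wC a l) ?(wC b l) ?(wC c l).
all: by [] || ring.
Qed.

Lemma simplicial_act_comm (a b c d : T) w :
  (forall k l, w k l = w l k) -> uniq [:: a; b; c; d] ->
  simplicial_act a b (simplicial_act c d w) =2
  simplicial_act c d (simplicial_act a b w).
Proof.
move=> wC; rewrite /= !inE !negb_or => /and4P[/and3P[ab ac ad] /andP[bc bd] cd _] k l.
have [kl|kl] := eqVneq k l; first by rewrite /simplicial_act kl eqxx.
pose u1 := simplicial_act c d w; pose v1 := simplicial_act a b w.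
rewrite -/u1 -/v1.
have Eu1 : u1 =2 simplicial_act c d w by [].
have Ev1 : v1 =2 simplicial_act a b w by [].
clearbody u1; clearbody v1.
have [kE|ka] := eqVneq k a; [|have [kE|kb] := eqVneq k b;
  [|have [kE|kc] := eqVneq k c; [|have [kE|kd] := eqVneq k d]]];
(have [lE|la] := eqVneq l a; [|have [lE|lb] := eqVneq l b;
  [|have [lE|lc] := eqVneq l c; [|have [lE|ld] := eqVneq l d]]]).
all: try by rewrite kE lE eqxx in kl.
all: subst; rewrite /simplicial_act; ev.
all: rewrite ?(Eu1, Ev1) /simplicial_act; ev.
all: rewrite ?(wC b a) ?(wC c a) ?(wC c b) ?(wC d a) ?(wC d b) ?(wC d c)
  ?(wC a k) ?(wC b k) ?(wC c k) ?(wC d k) ?(wC a l) ?(wC b l) ?(wC c l) ?(wC d l).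
all: by [] || ring.
Qed.

End SimplicialAction.

Section SimplicialMatrix.
Variables (R : realType) (n : nat) (q : R).
Local Notation N := 'C(n, 2).

(* e_{kl} = e_{lk} as a row vector, extended by e_{kk} = 0. *)
Definition ebasis (k l : 'I_n) : 'rV[R]_N :=
  \row_c ((val (rank_edge c) == (k, l)) || (val (rank_edge c) == (l, k)))%:R.

(* The row (e_{kl}) S_{ij}, with j = i + 1 and k < l; the last branch is the
   only remaining case k = j. *)
Definition simplicial_row (i : 'I_n.-1) (k l : 'I_n) : 'rV[R]_N :=
  let j := hi i in let i := lo i in
  if (k == i) && (l == j) then q ^+ 2 *: ebasis k l
  else if (i \notin [:: k; l]) && (j \notin [:: k; l]) then ebasis k l
  else if (k == i) && (j < l)%N then ebasis j l
  else if l == i then ebasis k j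
  else if (k < i)%N && (l == j) then
    (q ^+ 2 - q) *: ebasis i j + q *: ebasis k i + (1 - q) *: ebasis k l
  else
    (q ^+ 2 - q) *: ebasis i j + q *: ebasis i l + (1 - q) *: ebasis k l.

Definition simplicial_mx (i : 'I_n.-1) : 'M[R]_N :=
  \matrix_(r, c) simplicial_row i (val (rank_edge r)).1
                                  (val (rank_edge r)).2 0 c.

Definition colfun (v : 'cV[R]_N) (k l : 'I_n) : R := (ebasis k l *m v) 0 0.

Lemma ebasisC k l : ebasis k l = ebasis l k.
Proof. by apply/rowP => c; rewrite !mxE orbC. Qed.

Lemma colfunC v k l : colfun v k l = colfun v l k.
Proof. by rewrite /colfun ebasisC. Qed.

Lemma colfun_diag v k : colfun v k k = 0.
Proof.
rewrite /colfun mxE big1 // => c _; rewrite mxE.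
have /= := valP (rank_edge c); case: eqP => [->|_ _] /=; last by rewrite mul0r.
by rewrite ltnn.
Qed.

Lemma colfun_edge v (c : 'I_N) :
  colfun v (val (rank_edge c)).1 (val (rank_edge c)).2 = v c 0.
Proof.
rewrite /colfun mxE (bigD1 c) //= big1 ?addr0 => [|d dc].
  by rewrite mxE -surjective_pairing eqxx mul1r.
rewrite mxE -surjective_pairing; case: eqP => [/val_inj e|_] /=.
  by rewrite -(rank_edgeK d) e rank_edgeK eqxx in dc.
case: eqP => [e|_] /=; last by rewrite mul0r.
have /= := valP (rank_edge d); have /= := valP (rank_edge c).
by rewrite e /= => lt1 lt2; have := ltn_trans lt1 lt2; rewrite ltnn.
Qed.

Lemma colfun_inj v v' : (forall k l, colfun v k l = colfun v' k l) -> v = v'.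
Proof.
by move=> vv'; apply/colP => c; rewrite -!colfun_edge vv'.
Qed.

Lemma lo_hi_neq (i : 'I_n.-1) : lo i != hi i.
Proof. by rewrite -val_eqE /= neq_ltn ltnSn. Qed.

Lemma comb_mulmxE (a b c : R) (x y z : 'rV[R]_N) (v : 'cV[R]_N) :
  ((a *: x + b *: y + c *: z) *m v) 0 0 =
  a * (x *m v) 0 0 + b * (y *m v) 0 0 + c * (z *m v) 0 0.
Proof.
rewrite !mulmxDl -!scalemxAl.
by move: (x *m v) (y *m v) (z *m v) => X Y Z; rewrite !mxE.
Qed.

Lemma colfun_simplicial i v k l :
  colfun (simplicial_mx i *m v) k l = simplicial_act q (lo i) (hi i) (colfun v) k l.
Proof.
wlog kl : k l / (k < l)%N => [hwlog|].
  case: (ltngtP k l) => [/hwlog//|/hwlog lk|/val_inj->].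
    by rewrite colfunC lk simplicial_act_sym ?lo_hi_neq // => a b; apply: colfunC.
  by rewrite colfun_diag /simplicial_act eqxx.
have -> : colfun (simplicial_mx i *m v) k l = (simplicial_row i k l *m v) 0 0.
  pose e : edge n := mk_edge kl.
  have := colfun_edge (simplicial_mx i *m v) (edge_rank e).
  rewrite edge_rankK /= => ->; rewrite !mxE; apply: eq_bigr => c _.
  by rewrite mxE edge_rankK.
rewrite /simplicial_row /simplicial_act !inE !negb_or.
have -> : (k == l) = false by rewrite -val_eqE /= ltn_eqF.
have lohi := lo_hi_neq i.
rewrite ![lo i == _]eq_sym ![hi i == _]eq_sym.
case: (eqVneq k (lo i)) => [kE|ki] /=.
  case: (eqVneq l (hi i)) => [lE|lj] /=.
    by rewrite kE lE -scalemxAl mxE.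
  rewrite kE (negPf lohi) /=.
  have -> : (hi i < l)%N.
    by rewrite ltn_neqAle eq_sym val_eqE lj /=; move: kl; rewrite kE.
  by [].
case: (eqVneq l (lo i)) => [lE|li] /=.
  have -> : (k == hi i) = false.
    by apply/eqP => kE; move: kl; rewrite lE kE /= ltnNge leqnSn.
  by [].
case: (eqVneq k (hi i)) => [kE|kj] /=.
  have -> : (k < i)%N = false by rewrite kE /= ltnNge leqnSn.
  by rewrite comb_mulmxE.
case: (eqVneq l (hi i)) => [lE|lj] //=.
have -> : (k < i)%N.
  by rewrite ltn_neqAle -ltnS; move: kl ki; rewrite lE /= -val_eqE /= => -> ->.
by rewrite comb_mulmxE.
Qed.

Lemma simplicial_mx_unit (q0 : q != 0) i : simplicial_mx i \in unitmx.
Proof.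
rewrite -unitmx_tr -row_free_unit; apply: inj_row_free => u uS.
have S0 : simplicial_mx i *m u^T = 0 by rewrite -[LHS]trmxK trmx_mul trmxK uS trmx0.
apply: trmx_inj; rewrite trmx0; move: S0; set v := u^T => S0.
have act0 k l : simplicial_act q (lo i) (hi i) (colfun v) k l = 0.
  by rewrite -colfun_simplicial S0 /colfun mulmx0 mxE.
have ij := negPf (lo_hi_neq i); have ji := ij; rewrite eq_sym in ji.
have w_ij : colfun v (lo i) (hi i) = 0.
  have := act0 (lo i) (hi i); rewrite /simplicial_act ij !eqxx /=.
  by move/eqP; rewrite mulf_eq0 expf_eq0 (negPf q0) /= => /eqP.
have w_j l : colfun v (hi i) l = 0.
  have [->|jl] := eqVneq (hi i) l; first exact: colfun_diag.
  have [->|il] := eqVneq l (lo i); first by rewrite colfunC.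
  have := act0 (lo i) l; rewrite /simplicial_act ij eqxx /=.
  by rewrite eq_sym (negPf il) eq_sym (negPf jl).
have w_i l : colfun v (lo i) l = 0.
  have [->|il] := eqVneq l (lo i); first exact: colfun_diag.
  have [->//|lj] := eqVneq l (hi i).
  have := act0 (hi i) l; rewrite /simplicial_act (eq_sym (hi i) l) (negPf lj) ji.
  rewrite (negPf il) !eqxx /= w_ij w_j !mulr0 addr0 add0r.
  by move/eqP; rewrite mulf_eq0 (negPf q0) /= => /eqP.
apply: colfun_inj => k l.
have -> : colfun 0 k l = 0 by rewrite /colfun mulmx0 mxE.
have := act0 k l; rewrite /simplicial_act.
have [->|kl] := eqVneq k l; first by rewrite colfun_diag.
have [->|ki] := eqVneq k (lo i); first by move=> _; rewrite w_i.
have [->|li] := eqVneq l (lo i); first by move=> _; rewrite colfunC w_i.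
have [->|kj] := eqVneq k (hi i); first by move=> _; rewrite w_j.
by have [->|lj] := eqVneq l (hi i); first by move=> _; rewrite colfunC w_j.
Qed.

Lemma mx_colfunP (A B : 'M[R]_N) :
  (forall v k l, colfun (A *m v) k l = colfun (B *m v) k l) -> A = B.
Proof.
move=> AB; apply/matrixP => r c.
have /colP/(_ r) := colfun_inj (AB (delta_mx c 0)).
by rewrite -!colE !mxE.
Qed.

Lemma colfun_simplicialM i (A : 'M[R]_N) v k l :
  colfun (simplicial_mx i *m A *m v) k l =
  simplicial_act q (lo i) (hi i) (colfun (A *m v)) k l.
Proof. by rewrite -(mulmxA (simplicial_mx i) A v) (colfun_simplicial i (A *m v)). Qed.

Lemma simplicial_mx_comm (i j : 'I_n.-1) : (i.+2 <= j)%N ->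
  simplicial_mx i *m simplicial_mx j = simplicial_mx j *m simplicial_mx i.
Proof.
move=> ij; apply: mx_colfunP => v k l.
apply: etrans (colfun_simplicialM i (simplicial_mx j) v k l) _.
apply: etrans _ (esym (colfun_simplicialM j (simplicial_mx i) v k l)).
apply: etrans (simplicial_act_ext _ _ _ (colfun_simplicial j v) k l) _.
apply: etrans _ (esym (simplicial_act_ext _ _ _ (colfun_simplicial i v) k l)).
apply: simplicial_act_comm; first exact: colfunC.
rewrite /= !inE -!val_eqE /=; lia.
Qed.

Lemma simplicial_mx_braid (i j : 'I_n.-1) : j = i.+1 :> nat ->
  simplicial_mx i *m (simplicial_mx j *m simplicial_mx i) =
  simplicial_mx j *m (simplicial_mx i *m simplicial_mx j).
Proof.
move=> ij; apply: mx_colfunP => v k l.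
have step x y : colfun (simplicial_mx x *m simplicial_mx y *m v) =2
    simplicial_act q (lo x) (hi x) (simplicial_act q (lo y) (hi y) (colfun v)).
  move=> k' l'; apply: etrans (colfun_simplicialM x (simplicial_mx y) v k' l') _.
  exact: (simplicial_act_ext _ _ _ (colfun_simplicial y v) k' l').
set A := simplicial_mx j *m simplicial_mx i.
set B := simplicial_mx i *m simplicial_mx j.
apply: etrans (colfun_simplicialM i A v k l) _.
apply: etrans _ (esym (colfun_simplicialM j B v k l)).
apply: etrans (simplicial_act_ext _ _ _ (step j i) k l) _.
apply: etrans _ (esym (simplicial_act_ext _ _ _ (step i j) k l)).
have -> : lo j = hi i by apply: val_inj.
apply: simplicial_act_braid; first exact: colfunC.
- exact: lo_hi_neq.
- by rewrite -val_eqE /= ij neq_ltn ltnSn.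
- by rewrite -val_eqE /= ij neq_ltn ltnW.
Qed.

End SimplicialMatrix.

Section SimplicialRepresentation.
Variables (R : realType) (n : nat) (q : R).
Hypothesis q_gt0 : 0 < q.

Definition simplicial_gen (i : 'I_n.-1) : GL R 'C(n, 2) :=
  MkGL (simplicial_mx_unit (lt0r_neq0 q_gt0) i).

Definition simplicial_rep : Braid n -> GL R 'C(n, 2) :=
  braid_lift simplicial_gen.

Fact simplicial_gen_braid (i j : 'I_n.-1) : j = i.+1 :> nat ->
  (simplicial_gen i * simplicial_gen j * simplicial_gen i =
   simplicial_gen j * simplicial_gen i * simplicial_gen j)%g.
Proof.
move=> ij; rewrite -!mulgA; apply: val_inj.
exact: (simplicial_mx_braid q ij).
Qed.

Fact simplicial_gen_comm (i j : 'I_n.-1) : (i.+2 <= j)%N ->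
  (simplicial_gen i * simplicial_gen j = simplicial_gen j * simplicial_gen i)%g.
Proof. by move=> ij; apply: val_inj; apply: (simplicial_mx_comm q ij). Qed.

Fact simplicial_rep_multiplicative :
  {morph simplicial_rep : x y / (x * y)%g >-> (x * y)%g}.
Proof. exact: braid_liftM simplicial_gen_braid simplicial_gen_comm. Qed.

HB.instance Definition _ := isMultiplicative.Build (Braid n) (GL R 'C(n, 2))
  simplicial_rep simplicial_rep_multiplicative.

Lemma simplicial_rep_gen i :
  simplicial_rep (braid_gen i) = simplicial_mx q i :> 'M[R]_'C(n, 2).
Proof.
by rewrite /simplicial_rep (braid_lift_gen simplicial_gen_braid simplicial_gen_comm).
Qed.

End SimplicialRepresentation.

Section Simplices.
Variables (R : realType) (n : nat).
Local Open Scope classical_set_scope.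

(* The l2 norm; the library norm on matrices is the sup norm. *)
Definition euclidean_norm (d : nat) (x : 'rV[R]_d) : R :=
  Num.sqrt (\sum_(i < d) x 0 i ^+ 2).

Definition affinely_independent (d : nat) (p : 'I_n -> 'rV[R]_d) : Prop :=
  forall c : 'I_n -> R,
    \sum_i c i = 0 -> \sum_i c i *: p i = 0 -> forall i, c i = 0.

Definition simplex_sqlengths : set 'cV[R]_'C(n, 2) :=
  [set a : 'cV[R]_'C(n, 2) | (forall r, 0 < a r 0) /\
    exists p : 'I_n -> 'rV[R]_n.-1, affinely_independent p /\
      forall (k l : 'I_n) (kl : (k < l)%N),
        a (edge_rank (mk_edge kl)) 0 = euclidean_norm (p k - p l) ^+ 2].

End Simplices.

Arguments simplex_sqlengths : clear implicits.

(* Main.v *)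
Require Import Defs.
From mathcomp Require Import all_boot all_order all_algebra.
From mathcomp Require Import classical_sets reals.
From mathcomp Require Import ring.

(** Each generator acts on simplices, and not only on their edge lengths.
    Replace the vertices [p i] and [p j], with [j = i + 1], by [p j] and by the
    point [q p_i + (1 - q) p_j] of the line through them, and keep the other
    vertices.  By Stewart's theorem
      [|z - (q x + (1-q) y)|^2 = q |z-x|^2 + (1-q) |z-y|^2 + (q^2-q) |x-y|^2],
    the squared edge lengths of the new simplex are the image under [S_ij] of
    those of the old one ([simplicial_mx_sqlengths]).  The move is an invertible
    affine substitution of the vertices, so it preserves affine independence
    ([affinely_independent_slide]).  Its inverse is a move of the same kind, with
    [i] and [j] exchanged and [q] replaced by [q^-1] ([slideK]); so the inverse
    of a generator preserves simplices too, and every braid is a product of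
    generators and their inverses. *)

Set Implicit Arguments.
Unset Strict Implicit.
Unset Printing Implicit Defensive.

Import Order.TTheory GRing.Theory Num.Theory.

Local Open Scope ring_scope.

Section Slide.
Variables (R : fieldType) (n d : nat).
Implicit Types (i j k l : 'I_n) (t : R) (p : 'I_n -> 'rV[R]_d).

(** The half-twist of the strands [i] and [j], seen on a simplex: the two
    vertices are exchanged along their common line, one of them stopping at the
    ratio [t]; for [t = 1] they are just transposed. *)
Definition slide i j t p k : 'rV[R]_d :=
  if k == i then p j else if k == j then t *: p i + (1 - t) *: p j else p k.

Lemma slideK i j t p : i != j -> t != 0 ->
  slide i j t (slide j i t^-1 p) =1 p.
Proof.
move=> ij t0 k; rewrite /slide !eqxx (negPf ij).
have [->//|ki] := eqVneq k i; have [->|//] := eqVneq k j.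
by apply/rowP => c; rewrite !mxE; field.
Qed.

Definition sqdist (x y : 'rV[R]_d) : R := \sum_c (x 0 c - y 0 c) ^+ 2.

Lemma sqdistxx x : sqdist x x = 0.
Proof. by rewrite /sqdist big1 // => c _; rewrite subrr expr0n. Qed.

Lemma sqdistC x y : sqdist x y = sqdist y x.
Proof. by apply: eq_bigr => c _; ring. Qed.

Lemma sqdist_stewart t x y z :
  sqdist z (t *: x + (1 - t) *: y) =
  (t ^+ 2 - t) * sqdist x y + t * sqdist z x + (1 - t) * sqdist z y.
Proof.
rewrite /sqdist !mulr_sumr -!big_split; apply: eq_bigr => c _ /=.
by rewrite !mxE; ring.
Qed.

(** The edges at vertex [j] of the moved simplex are given by Stewart's theorem,
    and the edges at vertex [i] are those of the old vertex [j]. *)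
Lemma simplicial_act_sqdist i j t p k l : i != j ->
  simplicial_act t i j (fun a b => sqdist (p a) (p b)) k l =
  sqdist (slide i j t p k) (slide i j t p l).
Proof.
move=> ij; have ji := negPf ij; rewrite eq_sym in ji.
(* The edge [ij] itself is the case [z = y] of Stewart's theorem, in which the
   coefficients [t^2 - t] and [t] of [|x - y|^2] add up to [t^2]. *)
have stewart_j := sqdist_stewart t (p i) (p j) (p j).
rewrite sqdistxx (sqdistC (p j) (p i)) in stewart_j.
rewrite /simplicial_act /slide.
have [->|kl] := eqVneq k l; first by rewrite sqdistxx.
case: (eqVneq k i) kl => [->|ki] kl; [|case: (eqVneq k j) kl => [->|kj] kl];
  (case: (eqVneq l i) kl => [->|li] kl; [|case: (eqVneq l j) kl => [->|lj] kl]);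
  rewrite ?eqxx ?(negPf ij) ?ji //= ?eqxx in kl *.
- by rewrite stewart_j; ring.
- by rewrite [RHS]sqdistC stewart_j; ring.
- by rewrite [RHS]sqdistC sqdist_stewart !(sqdistC (p l)).
- by rewrite sqdist_stewart.
Qed.

End Slide.

Section AffineIndependence.
Variables (R : realType) (n d : nat).

Lemma sum_two (V : zmodType) (F : 'I_n -> V) (i j : 'I_n) : i != j ->
  \sum_k F k = F i + F j + \sum_(k | (k != i) && (k != j)) F k.
Proof.
by move=> ij; rewrite (bigD1 i) //= (bigD1 j) 1?eq_sym //= addrA.
Qed.

(** A combination of the moved vertices with coefficients [c] is a combination
    of the old ones, with the same sum of coefficients; the new coefficients
    [t c_j] at [i] and [c_i + (1 - t) c_j] at [j] determine [c] as [t] is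
    nonzero. *)
Lemma affinely_independent_slide (i j : 'I_n) (t : R) (p : 'I_n -> 'rV[R]_d) :
  i != j -> t != 0 ->
  affinely_independent p -> affinely_independent (slide i j t p).
Proof.
move=> ij t0 indep c c_sum c_comb; have ji := negPf ij; rewrite eq_sym in ji.
pose b k := if k == i then t * c j
            else if k == j then c i + (1 - t) * c j else c k.
have b_out k : k != i -> k != j -> b k = c k.
  by move=> /negPf ki /negPf kj; rewrite /b ki kj.
have b_i : b i = t * c j by rewrite /b eqxx.
have b_j : b j = c i + (1 - t) * c j by rewrite /b ji eqxx.
have b0 : forall k, b k = 0.
  apply: indep.
    apply: etrans c_sum; rewrite !(sum_two _ ij) b_i b_j; congr (_ + _); first by ring.
    by apply: eq_bigr => k /andP[ki kj]; rewrite b_out.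
  apply: etrans c_comb; rewrite !(sum_two _ ij) b_i b_j; congr (_ + _).
    by rewrite /slide !eqxx ji; apply/rowP => a; rewrite !mxE; ring.
  apply: eq_bigr => k /andP[ki kj].
  by rewrite b_out // /slide (negPf ki) (negPf kj).
have cj : c j = 0.
  by have := b0 i; rewrite b_i => /eqP; rewrite mulf_eq0 (negPf t0) => /eqP.
move=> k; have [->|ki] := eqVneq k i.
  by have := b0 j; rewrite b_j cj mulr0 addr0.
by have [->//|kj] := eqVneq k j; rewrite -b_out.
Qed.

Lemma affinely_independent_sqdist_gt0 (p : 'I_n -> 'rV[R]_d) (k l : 'I_n) :
  affinely_independent p -> k != l -> 0 < sqdist (p k) (p l).
Proof.
move=> indep kl; rewrite lt0r sumr_ge0 => [|c _]; last exact: sqr_ge0.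
rewrite andbT; apply/eqP => dist0.
have pkl : p k = p l.
  apply/rowP => c; apply/eqP; rewrite -subr_eq0 -sqrf_eq0; apply/eqP.
  by apply: (psumr_eq0P _ dist0) => // a _; apply: sqr_ge0.
have lk := negPf kl; rewrite eq_sym in lk.
pose b m : R := if m == k then 1 else if m == l then -1 else 0.
have b_out (m : 'I_n) : (m != k) && (m != l) -> b m = 0.
  by rewrite /b => /andP[/negPf-> /negPf->].
have : b k = 0.
  apply: indep; rewrite (sum_two _ kl) /b !eqxx lk.
    by rewrite subrr add0r big1.
  rewrite pkl scale1r scaleN1r subrr add0r big1 // => m mkl.
  by rewrite -[X in X *: _]/(b m) b_out ?scale0r.
by move/eqP; rewrite /b eqxx oner_eq0.
Qed.

End AffineIndependence.

Section SquaredLengths.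
Variables (R : realType) (n : nat).

Definition sqlengths d (p : 'I_n -> 'rV[R]_d) : 'cV[R]_'C(n, 2) :=
  \col_r sqdist (p (val (rank_edge r)).1) (p (val (rank_edge r)).2).

Lemma eq_sqlengths d (p p' : 'I_n -> 'rV[R]_d) :
  p =1 p' -> sqlengths p = sqlengths p'.
Proof. by move=> pp'; apply/colP => r; rewrite !mxE !pp'. Qed.

Lemma colfun_sqlengths d (p : 'I_n -> 'rV[R]_d) k l :
  colfun (sqlengths p) k l = sqdist (p k) (p l).
Proof.
wlog kl : k l / (k < l)%N => [hwlog|].
  case: (ltngtP k l) => [/hwlog//|/hwlog lk|/val_inj->].
    by rewrite colfunC lk sqdistC.
  by rewrite colfun_diag sqdistxx.
have := colfun_edge (sqlengths p) (edge_rank (mk_edge kl)).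
by rewrite mxE edge_rankK.
Qed.

Lemma simplicial_mx_sqlengths d (q : R) (i : 'I_n.-1) (p : 'I_n -> 'rV[R]_d) :
  simplicial_mx q i *m sqlengths p = sqlengths (slide (lo i) (hi i) q p).
Proof.
apply: colfun_inj => k l; rewrite colfun_simplicial colfun_sqlengths.
rewrite (simplicial_act_ext _ _ _ (colfun_sqlengths p)).
exact/simplicial_act_sqdist/lo_hi_neq.
Qed.

Lemma simplex_sqlengthsP (v : 'cV[R]_'C(n, 2)) :
  simplex_sqlengths R n v <->
  exists2 p : 'I_n -> 'rV[R]_n.-1, affinely_independent p & v = sqlengths p.
Proof.
have normE (x y : 'rV[R]_n.-1) : euclidean_norm (x - y) ^+ 2 = sqdist x y.
  rewrite sqr_sqrtr; last by apply: sumr_ge0 => c _; apply: sqr_ge0.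
  by apply: eq_bigr => c _; rewrite !mxE.
split=> [[_ [p [indep vp]]]|[p indep ->]].
  exists p => //; apply/colP => r; rewrite mxE -[in LHS](rank_edgeK r).
  by case: (rank_edge r) => -[k l] kl; rewrite -normE -vp.
split=> [r|].
  rewrite mxE; apply: affinely_independent_sqdist_gt0 => //.
  by have := valP (rank_edge r); rewrite /= ltn_neqAle => /andP[].
by exists p; split=> // k l kl; rewrite mxE edge_rankK normE.
Qed.

Lemma simplicial_mx_simplex (q : R) (i : 'I_n.-1) v : q != 0 ->
  simplex_sqlengths R n v -> simplex_sqlengths R n (simplicial_mx q i *m v).
Proof.
move=> q0 /simplex_sqlengthsP[p indep ->]; rewrite simplicial_mx_sqlengths.
apply/simplex_sqlengthsP; exists (slide (lo i) (hi i) q p) => //.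
exact: affinely_independent_slide (lo_hi_neq i) q0 indep.
Qed.

Lemma invmx_simplicial_mx_simplex (q : R) (i : 'I_n.-1) v : q != 0 ->
  simplex_sqlengths R n v ->
  simplex_sqlengths R n (invmx (simplicial_mx q i) *m v).
Proof.
move=> q0 /simplex_sqlengthsP[p indep ->]; apply/simplex_sqlengthsP.
have lohi := lo_hi_neq i.
exists (slide (hi i) (lo i) q^-1 p).
  apply: (affinely_independent_slide _ _ indep); last by rewrite invr_eq0.
  by rewrite eq_sym.
rewrite -[RHS](mulKmx (simplicial_mx_unit q0 i)) simplicial_mx_sqlengths.
by congr (_ *m _); apply: eq_sqlengths => k; rewrite slideK.
Qed.

End SquaredLengths.

Theorem theoremA (R : realType) (n : nat) (n_ge2 : (2 <= n)%N)
    (q : R) (q_gt0 : 0 < q) (beta : Braid n) (v : 'cV[R]_'C(n, 2)) :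
  simplex_sqlengths R n v ->
  simplex_sqlengths R n (simplicial_rep q_gt0 beta *m v).
Proof.
move=> v_simplex; rewrite /simplicial_rep /braid_lift.
have q0 := lt0r_neq0 q_gt0.
elim: (generic_quotient.repr beta) => [|[i b] w IHw]; first by rewrite mul1mx.
rewrite /= -mulmxA; case: b; first exact: simplicial_mx_simplex.
exact: invmx_simplicial_mx_simplex.
Qed.
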